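(* Let $N\ge2$, let $\epsilon>0$, and let $\mathbf w^{\mathrm{start}},\mathbf w^{\mathrm{end}}\in\Delta^{N-1}$ have weights bounded away from zero: $\min_i w_i\ge\epsilon>0$ for the weight vectors along the SLERP path from $\mathbf w^{\mathrm{start}}$ to $\mathbf w^{\mathrm{end}}$ (endpoints included). Let $\Omega=\arccos\left(\sum_i\sqrt{w_i^{\mathrm{start}}w_i^{\mathrm{end}}}\right)$. For an integer $f\ge1$ let $C_{\mathrm{SLERP}}(f)$ and $C_*(f)$ denote the total exact KL cost $$\sum_{k=1}^f D_{\mathrm{KL}}\left(\mathbf w^{(k)}\,\|\,\mathbf w^{(k-1)}\right)$$ along the $f$-step SLERP path and along the globally optimal $f$-step path from $\mathbf w^{\mathrm{start}}$ to $\mathbf w^{\mathrm{end}}$, respectively. Then there is a constant $A$, depending on the weight configuration and on $\epsilon$ but not on $f$, such that for all integers $f\ge 4\Omega/\epsilon$, $$0\le C_{\mathrm{SLERP}}(f)-C_*(f)\le\frac{A\,\Omega^4}{f^3}.$$ The relative sub-optimality $\left(C_{\mathrm{SLERP}}(f)-C_*(f)\right)/C_{\mathrm{SLERP}}(f)$ is $O(\Omega^2/f^2)$.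
   Context: $\Delta^{N-1}=\{\mathbf w\in\mathbb R^N:w_i>0,\sum_iw_i=1\}$ and $D_{\mathrm{KL}}(p\,\|\,q)=\sum_ip_i\log(p_i/q_i)$. An $f$-step path from $\mathbf w^{\mathrm{start}}$ to $\mathbf w^{\mathrm{end}}$ is a sequence $\mathbf w^{(0)}=\mathbf w^{\mathrm{start}},\mathbf w^{(1)},\dots,\mathbf w^{(f)}=\mathbf w^{\mathrm{end}}$ in $\Delta^{N-1}$; $C_*(f)$ is the infimum of the total exact KL cost over all such paths. The $f$-step SLERP path is $$w_i^{(k)}=\left[\frac{\sin((1-\frac kf)\Omega)}{\sin\Omega}\sqrt{w_i^{\mathrm{start}}}+\frac{\sin(\frac kf\Omega)}{\sin\Omega}\sqrt{w_i^{\mathrm{end}}}\right]^2,\quad k=0,\dots,f$$ (the constant path if $\Omega=0$; in that case both costs vanish and the relative statement is vacuous). *)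

(* Defs.v *)
From mathcomp Require Import all_boot all_order all_algebra.
From mathcomp Require Import all_classical all_reals all_analysis.

Set Implicit Arguments.
Unset Strict Implicit.
Unset Printing Implicit Defensive.

Import Order.TTheory GRing.Theory Num.Theory.

Local Open Scope classical_set_scope.
Local Open Scope ring_scope.

(* Open simplex: all weights are strictly positive, so [KL] below is only ever
   evaluated where the logarithms are genuine. *)
Definition simplex (R : realType) (N : nat) : set 'rV[R]_N :=
  [set w | (forall i, 0 < w 0 i) /\ \sum_i w 0 i = 1].

Definition KL (R : realType) (N : nat) (p q : 'rV[R]_N) : R :=
  \sum_i p 0 i * ln (p 0 i / q 0 i).

Definition Omega (R : realType) (N : nat) (u v : 'rV[R]_N) : R :=
  acos (\sum_i Num.sqrt (u 0 i * v 0 i)).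

(* The case [Omega u v = 0] (i.e. [u = v] on the simplex) is separate because
   there the coefficients [sin _ / sin 0] would be [0] by convention. *)
Definition slerp (R : realType) (N : nat) (u v : 'rV[R]_N) (t : R) : 'rV[R]_N :=
  if Omega u v == 0 then u else
  \row_i (sin ((1 - t) * Omega u v) / sin (Omega u v) * Num.sqrt (u 0 i) +
          sin (t * Omega u v) / sin (Omega u v) * Num.sqrt (v 0 i)) ^+ 2.

(* Sequences are total functions on [nat]; only indices [k <= f] matter. *)
Definition is_path (R : realType) (N : nat) (u v : 'rV[R]_N) (f : nat)
    (w : nat -> 'rV[R]_N) : Prop :=
  [/\ w 0%N = u, w f = v & forall k, (k <= f)%N -> simplex (w k)].

Definition path_cost (R : realType) (N : nat) (f : nat)
    (w : nat -> 'rV[R]_N) : R :=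
  \sum_(1 <= k < f.+1) KL (w k) (w k.-1).

Definition C_SLERP (R : realType) (N : nat) (u v : 'rV[R]_N) (f : nat) : R :=
  path_cost f (fun k => slerp u v (k%:R / f%:R)).

(* For [f >= 1] and [u], [v] in the simplex the set is nonempty and bounded
   below by [0], so [inf] is the true infimum. *)
Definition C_star (R : realType) (N : nat) (u v : 'rV[R]_N) (f : nat) : R :=
  inf [set path_cost f w | w in is_path u v f].

(* Main.v *)
(* In the coordinates [x = sqrt w] the KL cost is a sum over coordinates of
   [sqrt_kl x y = 2 x^2 ln (x/y) - x^2 + y^2].  With [d = x - y], this dominates
   [kl_jet x y = 2 d^2 + (4/3) d^3 / (x + y)] for all positive [x], [y], and
   exceeds it by at most O(d^4) when [x], [y] stay away from 0.

   Lower bound for an arbitrary path: raising every coordinate below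
   [m = sqrt eps] to [m] does not increase the cost, and pushes the path out of
   the open unit ball.  Let [s] be the SLERP path, [x] the truncated path and
   [z = x - s], so that [z] vanishes at both ends.  Since [s] satisfies
   [s_(k+1) + s_(k-1) = 2 cos (Omega/f) s_k], summation by parts gives
   [sum |dx|^2 - sum |ds|^2 >= sum |dz|^2 - (Omega/f)^2 sum |z|^2], and a discrete
   Poincare inequality with [Omega < 2] makes the right side at least
   [c sum |dz|^2].  The cubic terms of [x] and [s] differ by a small multiple of
   [sum |dz|^2] plus O(f^-2) times [sum |dz|]; as [(sum |dz|)^2 <= f sum |dz|^2],
   completing the square loses only O(f^-3).  Paths with a large step, and small
   [f], are handled by the crude bound C_SLERP(f) = O(1/f). *)
Require Import Defs.
From mathcomp Require Import all_boot all_order all_algebra.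
From mathcomp Require Import all_classical all_reals all_analysis.
From mathcomp Require Import ring lra.

Set Implicit Arguments.
Unset Strict Implicit.
Unset Printing Implicit Defensive.

Import Order.TTheory GRing.Theory Num.Theory.
Import numFieldNormedType.Exports.

Local Open Scope ring_scope.

(** * Fourth-order rational bounds for the logarithm *)

(** The sign condition makes [f] decrease before 1 and increase after it, so the value 0 at 1 is a
    minimum; the mean value theorem is applied between [t] and 1. *)
Lemma derive_sign_ge0 (R : realType) (f df : R -> R) (b t : R) :
  0 < b -> b <= 1 -> b <= t ->
  (forall s : R, 0 < s -> is_derive s 1 f (df s)) -> f 1 = 0 ->
  (forall s : R, b <= s -> 0 <= (s - 1) * df s) -> 0 <= f t.
Proof.
move=> b0 b1 bt fdf f1 dfs.
have cont (x y : R) : 0 < x -> {within `[x, y], continuous f}%classic.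
  move=> x0; apply: derivable_within_continuous => s /itvP sI.
  have s0 : 0 < s by apply: lt_le_trans x0 _; rewrite sI.
  by apply: ex_derive; apply: fdf.
case: (ltgtP t 1) => [t1|t1|->]; last by rewrite f1.
- have t0 : 0 < t by exact: lt_le_trans bt.
  have der : forall x, x \in `]t, 1[ -> is_derive x 1 f (df x).
    by move=> x /itvP xI; apply: fdf; apply: lt_trans t0 _; rewrite xI.
  have [c /itvP cI e] := MVT t1 der (cont _ _ t0).
  have c1 : c < 1 by rewrite cI.
  have tc : t < c by rewrite cI.
  have := dfs c (ltW (le_lt_trans bt tc)).
  have d0 : 0 < 1 - t by rewrite subr_gt0.
  move=> h; have hd : df c <= 0 by nra.
  by nra.
- have der : forall x, x \in `]1, t[ -> is_derive x 1 f (df x).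
    by move=> x /itvP xI; apply: fdf; apply: lt_trans ltr01 _; rewrite xI.
  have [c /itvP cI e] := MVT t1 der (cont _ _ ltr01).
  have c1 : 1 < c by rewrite cI.
  have := dfs c (ltW (le_lt_trans b1 c1)).
  have d0 : 0 < t - 1 by rewrite subr_gt0.
  move=> h; have hd : 0 <= df c by nra.
  by nra.
Qed.

(* Chosen so that replacing [ln (x / y)] by [log_approx (x / y)] in [sqrt_kl x y]
   below gives [kl_jet x y] exactly. *)
Definition log_approx (R : realType) (t : R) : R :=
  (t - 1) * (13 * t ^+ 2 - 2 * t + 1) / (6 * (t ^+ 2 * (t + 1))).

(** The derivative of [ln t - log_approx t]. The cube of [t - 1] means that the error vanishes to
    fourth order at 1 and fixes the sign on each side. *)
Definition log_err_deriv (R : realType) (t : R) : R :=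
  (t - 1) ^+ 3 * (3 * t + 1) / (3 * (t ^+ 3 * (t + 1) ^+ 2)).

Lemma is_derive_log_err (R : realType) (t : R) : 0 < t ->
  is_derive t 1 (fun s : R => ln s - log_approx s) (log_err_deriv t).
Proof.
move=> t0.
have h1 : is_derive t 1 (@ln R) t^-1 by apply: is_derive1_ln.
have t1 : t + 1 != 0 by apply: lt0r_neq0; lra.
have tn0 : t != 0 by apply: lt0r_neq0.
have den : 6 * (t ^+ 2 * (t + 1)) != 0 :> R.
  by rewrite !mulf_neq0 // ?expf_neq0 // pnatr_eq0.
rewrite /log_approx.
apply: is_derive_eq.
rewrite /log_err_deriv /GRing.scale /=.
field.
by rewrite tn0 t1.
Qed.

Lemma log_err_ge0 (R : realType) (t : R) : 0 < t -> 0 <= ln t - log_approx t.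
Proof.
(* The sign condition has to hold on a half-line containing both [t] and 1. *)
move=> t0; pose b := Num.min t 1.
have b0 : 0 < b by rewrite lt_min t0 ltr01.
apply: (@derive_sign_ge0 R (fun s => ln s - log_approx s) (@log_err_deriv R) b) => //.
- by rewrite ge_min lexx orbT.
- by rewrite ge_min lexx.
- exact: is_derive_log_err.
- by rewrite ln1 /log_approx subrr !mul0r subr0.
- move=> s bs; have s0 : 0 < s by exact: lt_le_trans bs.
  rewrite /log_err_deriv.
  have -> : (s - 1) * ((s - 1) ^+ 3 * (3 * s + 1) / (3 * (s ^+ 3 * (s + 1) ^+ 2))) =
     ((s - 1) ^+ 2) ^+ 2 * (3 * s + 1) / (3 * (s ^+ 3 * (s + 1) ^+ 2)).
    by rewrite [LHS]mulrA; congr (_ / _); ring.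
  have d0 : 0 < 3 * (s ^+ 3 * (s + 1) ^+ 2).
    by rewrite !mulr_gt0 ?exprn_gt0 //; lra.
  apply: divr_ge0; last exact: ltW.
  by apply: mulr_ge0; [exact: sqr_ge0 | lra].
Qed.

(** The right side has derivative [(t - 1)^3 / m^3], which dominates [log_err_deriv] in absolute
    value: [t >= m], and [3 t + 1 <= 3 (t + 1)^2]. *)
Lemma log_err_le (R : realType) (m t : R) : 0 < m -> m <= 1 -> m <= t ->
  ln t - log_approx t <= (t - 1) ^+ 4 / (4 * m ^+ 3).
Proof.
move=> m0 m1 mt; rewrite -subr_ge0.
have m3 : 0 < m ^+ 3 by exact: exprn_gt0.
pose c := (4 * m ^+ 3)^-1.
have der (s : R) : 0 < s -> is_derive s 1
    (fun s : R => (s - 1) ^+ 4 * c - (ln s - log_approx s))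
    (4 * c * (s - 1) ^+ 3 - log_err_deriv s).
  move=> s0; have h := is_derive_log_err s0.
  by apply: is_derive_eq; rewrite /GRing.scale /=; ring.
apply: (derive_sign_ge0 m0 m1 mt der).
  by rewrite ln1 /log_approx subrr !mul0r expr0n mul0r !subr0.
have -> : 4 * c = (m ^+ 3)^-1 by rewrite /c; field; rewrite lt0r_neq0.
move=> s ms; have s0 : 0 < s by exact: lt_le_trans ms.
  have s3 : m ^+ 3 <= s ^+ 3 by apply: lerXn2r; rewrite // nnegrE ltW.
  have -> : (s - 1) * ((m ^+ 3)^-1 * (s - 1) ^+ 3 - log_err_deriv s) =
     ((s - 1) ^+ 2) ^+ 2 * ((m ^+ 3)^-1 - (3 * s + 1) / (3 * (s ^+ 3 * (s + 1) ^+ 2))).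
    rewrite /log_err_deriv; field.
    by rewrite !lt0r_neq0 //; lra.
  apply: mulr_ge0; first exact: sqr_ge0.
  have s30 : 0 < s ^+ 3 by exact: exprn_gt0.
  have d0 : 0 < 3 * (s ^+ 3 * (s + 1) ^+ 2).
    by rewrite !mulr_gt0 ?exprn_gt0 //; lra.
  rewrite subr_ge0 ler_pdivrMr // [leRHS]mulrC ler_pdivlMr //.
  have h : 3 * s + 1 <= 3 * (s + 1) ^+ 2 by nra.
  apply: le_trans (_ : 3 * (s + 1) ^+ 2 * s ^+ 3 <= _).
    by apply: ler_pM => //; [nra | exact: ltW].
  by rewrite le_eqVlt; apply/orP; left; apply/eqP; ring.
Qed.

(** * The cost of one coordinate in square-root coordinates *)

(** With [p = x^2] and [q = y^2] this is [p ln(p/q) - p + q], the Bregman divergence of [p ln p].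
    The terms [- p + q] make each coordinate nonnegative and keep the cost meaningful after
    truncation, when the masses no longer sum to 1. *)
Definition sqrt_kl (R : realType) (x y : R) : R :=
  2 * x ^+ 2 * ln (x / y) - x ^+ 2 + y ^+ 2.

(** The third-order Taylor polynomial of [sqrt_kl x y] in [x - y], taken about the midpoint
    [(x + y) / 2]. *)
Definition kl_jet (R : realType) (x y : R) : R :=
  2 * (x - y) ^+ 2 + 4 / 3 * ((x - y) ^+ 3 / (x + y)).

Lemma sqrt_klE (R : realType) (x y : R) : 0 < x -> 0 < y ->
  sqrt_kl x y = kl_jet x y + 2 * x ^+ 2 * (ln (x / y) - log_approx (x / y)).
Proof.
move=> x0 y0; rewrite /sqrt_kl /kl_jet /log_approx.
move: (ln _) => l; field.
by rewrite !lt0r_neq0 ?addr_gt0.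
Qed.

Lemma kl_jet_le (R : realType) (x y : R) : 0 < x -> 0 < y ->
  kl_jet x y <= sqrt_kl x y.
Proof.
move=> x0 y0; rewrite sqrt_klE // lerDl.
apply: mulr_ge0; first by rewrite mulr_ge0 ?sqr_ge0.
by apply: log_err_ge0; rewrite divr_gt0.
Qed.

(** The power [m ^+ 7] collects [m ^+ 3] from the logarithm error at the ratio [x / y >= m] and
    [m ^+ 4] from [(x / y - 1)^4 = (x - y)^4 / y^4]. *)
Lemma sqrt_kl_le_jet (R : realType) (m x y : R) : 0 < m ->
  m <= x <= 1 -> m <= y <= 1 ->
  sqrt_kl x y <= kl_jet x y + (x - y) ^+ 4 / (2 * m ^+ 7).
Proof.
move=> m0 /andP[mx x1] /andP[my y1].
have x0 : 0 < x by exact: lt_le_trans mx.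
have y0 : 0 < y by exact: lt_le_trans my.
rewrite sqrt_klE // lerD2l.
have mt : m <= x / y by rewrite ler_pdivlMr //; nra.
have h := log_err_le m0 (le_trans mx x1) mt.
have x21 : x ^+ 2 <= 1 by rewrite expr_le1 // ltW.
have d4 : 0 <= (x / y - 1) ^+ 4 by exact: exprn_even_ge0.
have m3 : 0 < m ^+ 3 by exact: exprn_gt0.
apply: le_trans (_ : 2 * ((x / y - 1) ^+ 4 / (4 * m ^+ 3)) <= _).
  rewrite -mulrA ler_pM2l //.
  have g0 : 0 <= ln (x / y) - log_approx (x / y) by rewrite log_err_ge0 ?divr_gt0.
  by apply: le_trans (ler_wpM2r g0 x21) _; rewrite mul1r.
have -> : 2 * ((x / y - 1) ^+ 4 / (4 * m ^+ 3)) =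
          (x - y) ^+ 4 / (2 * m ^+ 3) / y ^+ 4.
  by field; rewrite !lt0r_neq0.
have -> : (x - y) ^+ 4 / (2 * m ^+ 7) = (x - y) ^+ 4 / (2 * m ^+ 3) / m ^+ 4.
  by field; rewrite lt0r_neq0.
apply: ler_wpM2l.
  by apply: divr_ge0; [exact: exprn_even_ge0 | rewrite mulr_ge0 // ltW].
rewrite lef_pV2 ?posrE ?exprn_gt0 //.
by apply: lerXn2r => //; rewrite nnegrE ltW.
Qed.

(** Since [(x - y) / (x + y) >= -1], the cubic term consumes at most 4/3 of the coefficient 2. *)
Lemma kl_jet_ge (R : realType) (x y : R) : 0 < x -> 0 < y ->
  2 / 3 * (x - y) ^+ 2 <= kl_jet x y.
Proof.
move=> x0 y0; rewrite /kl_jet.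
have -> : (x - y) ^+ 3 / (x + y) = (x - y) ^+ 2 * ((x - y) / (x + y)).
  by rewrite mulrA; congr (_ / _); ring.
have h : -1 <= (x - y) / (x + y) by rewrite ler_pdivlMr ?addr_gt0 //; lra.
have h2 := sqr_ge0 (x - y).
by nra.
Qed.

(** A crude quadratic bound from [ln t <= t - 1]; it serves the estimate C_SLERP(f) = O(1/f). *)
Lemma sqrt_kl_le (R : realType) (m x y : R) : 0 < m ->
  0 < x -> x <= 1 -> m <= y <= 1 -> sqrt_kl x y <= 3 / m * (x - y) ^+ 2.
Proof.
move=> m0 x0 x1 /andP[my y1].
have y0 : 0 < y by exact: lt_le_trans my.
have q0 : 0 < x / y by rewrite divr_gt0.
have hl : ln (x / y) <= x / y - 1.
  by have := @le_ln1Dx R (x / y - 1); rewrite addrCA subrr addr0; apply; lra.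
apply: le_trans (_ : (x - y) ^+ 2 * ((2 * x + y) / y) <= _).
  have -> : (x - y) ^+ 2 * ((2 * x + y) / y) =
      2 * x ^+ 2 * (x / y - 1) - x ^+ 2 + y ^+ 2.
    by field; rewrite lt0r_neq0.
  rewrite /sqrt_kl lerD2r lerD2r; apply: ler_wpM2l => //.
  by rewrite mulr_ge0 ?sqr_ge0.
rewrite mulrC; apply: ler_wpM2r; first exact: sqr_ge0.
by apply: ler_pM => //; [lra | rewrite invr_ge0 ltW | lra | rewrite lef_pV2 ?posrE].
Qed.

Lemma sqrt_kl_ge0 (R : realType) (x y : R) : 0 < x -> 0 < y -> 0 <= sqrt_kl x y.
Proof.
move=> x0 y0; apply: le_trans (kl_jet_le x0 y0).
by apply: le_trans (kl_jet_ge x0 y0); rewrite mulr_ge0 ?sqr_ge0 //; lra.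
Qed.

Lemma sqrt_klxx (R : realType) (x : R) : 0 < x -> sqrt_kl x x = 0.
Proof. by move=> x0; rewrite /sqrt_kl divff ?lt0r_neq0 // ln1 mulr0 sub0r addNr. Qed.

(** The three-point identity of Bregman divergences; [2 * ln (m / y)] is the difference of the
    gradients [ln m^2] and [ln y^2]. *)
Lemma sqrt_kl_three_point (R : realType) (x m y : R) : 0 < x -> 0 < m -> 0 < y ->
  sqrt_kl x y = sqrt_kl x m + sqrt_kl m y + 2 * (x ^+ 2 - m ^+ 2) * ln (m / y).
Proof.
move=> x0 m0 y0; rewrite /sqrt_kl !ln_div ?posrE //.
by ring.
Qed.

(** When [m] separates [x] and [y], the two factors of the last term of the three-point identity
    have the same sign, and the truncated cost is one of the two nonnegative summands before it. *)
Lemma sqrt_kl_max (R : realType) (m x y : R) : 0 < m -> 0 < x -> 0 < y ->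
  sqrt_kl (Num.max x m) (Num.max y m) <= sqrt_kl x y.
Proof.
move=> m0 x0 y0.
have H := sqrt_kl_three_point x0 m0 y0.
case: (leP x m) => xm; case: (leP y m) => ym.
- by rewrite sqrt_klxx ?sqrt_kl_ge0.
- have : ln (m / y) <= 0 by rewrite ln_le0 // ler_pdivrMr // mul1r ltW.
  have := sqrt_kl_ge0 x0 m0.
  have : x ^+ 2 <= m ^+ 2 by apply: lerXn2r; rewrite ?nnegrE //; exact: ltW.
  by nra.
- have : 0 <= ln (m / y) by rewrite ln_ge0 // ler_pdivlMr // mul1r.
  have := sqrt_kl_ge0 m0 y0.
  have : m ^+ 2 <= x ^+ 2 by apply: lerXn2r; rewrite ?nnegrE //; exact: ltW.
  by nra.
- by [].
Qed.

Lemma KL_sqrt (R : realType) (N : nat) (p q : 'rV[R]_N) :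
  simplex p -> simplex q ->
  KL p q = \sum_i sqrt_kl (Num.sqrt (p 0 i)) (Num.sqrt (q 0 i)).
Proof.
move=> [p0 p1] [q0 q1].
(* Both masses are 1, so subtracting one and adding the other completes each term to [sqrt_kl]. *)
have -> : KL p q = KL p q - \sum_i p 0 i + \sum_i q 0 i.
  by rewrite p1 q1 subrK.
rewrite /KL -sumrB -big_split /=; apply: eq_bigr => i _.
have sp : 0 < Num.sqrt (p 0 i) by rewrite sqrtr_gt0.
have sq : 0 < Num.sqrt (q 0 i) by rewrite sqrtr_gt0.
rewrite /sqrt_kl !sqr_sqrtr ?ltW //; congr (_ - _ + _).
have {1}-> : p 0 i / q 0 i = (Num.sqrt (p 0 i) / Num.sqrt (q 0 i)) ^+ 2.
  by rewrite expr_div_n !sqr_sqrtr ?ltW.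
by rewrite lnXn ?divr_gt0 // -mulr_natl; ring.
Qed.

(** * Sums over the steps of a path *)

(** Cauchy-Schwarz against a constant sequence, read off from the sum of the squares of
    [n a_k - S]. *)
Lemma sqr_sum_le (R : realFieldType) (a : nat -> R) (n : nat) :
  (\sum_(0 <= k < n) a k) ^+ 2 <= n%:R * \sum_(0 <= k < n) a k ^+ 2.
Proof.
set S := \sum_(0 <= k < n) a k; set Q := \sum_(0 <= k < n) a k ^+ 2.
case: n @S @Q => [|n] S Q; first by rewrite /S big_nil expr0n mul0r.
have : 0 <= \sum_(0 <= k < n.+1) (n.+1%:R * a k - S) ^+ 2.
  by apply: sumr_ge0 => k _; exact: sqr_ge0.
have -> : \sum_(0 <= k < n.+1) (n.+1%:R * a k - S) ^+ 2 =
    n.+1%:R * (n.+1%:R * Q - S ^+ 2).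
  under eq_bigr do rewrite sqrrB.
  rewrite big_split sumrB /= sumr_const_nat subn0.
  have -> : \sum_(0 <= k < n.+1) (n.+1%:R * a k) ^+ 2 = n.+1%:R ^+ 2 * Q.
    by rewrite big_distrr /=; apply: eq_bigr => k _; rewrite exprMn.
  have -> : \sum_(0 <= k < n.+1) (n.+1%:R * a k * S) *+ 2 = 2 * n.+1%:R * S * S.
    rewrite sumrMnl -mulr_natl -big_distrl /= -big_distrr /= -/S; ring.
  rewrite -mulr_natl; ring.
by rewrite pmulr_rge0 ?ltr0Sn // subr_ge0.
Qed.

(** The value [z k] is reached from 0 and returns to 0, and each half of the journey has variation
    at least [|z k|]. The resulting factor 2 becomes the 1/4 in the Poincare inequality, so that an
    angle below 2 suffices. *)
Lemma norm_le_variation (R : realDomainType) (z : nat -> R) (n k : nat) :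
  z 0%N = 0 -> z n = 0 -> (k <= n)%N ->
  2 * `|z k| <= \sum_(0 <= j < n) `|z j.+1 - z j|.
Proof.
move=> z0 zn kn; rewrite (big_cat_nat (leq0n k) kn) /= mulr_natl mulr2n.
apply: lerD.
  have -> : z k = \sum_(0 <= j < k) (z j.+1 - z j).
    by rewrite telescope_sumr // z0 subr0.
  exact: ler_norm_sum.
have -> : `|z k| = `|\sum_(k <= j < n) (z j.+1 - z j)|.
  by rewrite telescope_sumr // zn sub0r normrN.
exact: ler_norm_sum.
Qed.

(** Summation by parts: the recurrence says that the second difference of [s] is [- mu * s]. *)
Lemma abel_sum (R : comNzRingType) (mu : R) (s z : nat -> R) (n : nat) :
  (forall k, s k.+2 + s k = (2 - mu) * s k.+1) -> z 0%N = 0 ->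
  \sum_(0 <= k < n.+1) (s k.+1 - s k) * (z k.+1 - z k) =
  (s n.+1 - s n) * z n.+1 + mu * \sum_(0 <= k < n.+1) s k * z k.
Proof.
move=> rec z0; elim: n => [|n IH].
  by rewrite !big_nat1 z0 !mulr0 addr0 subr0.
rewrite big_nat_recr //= IH [in RHS]big_nat_recr //= mulrDr.
have -> : s n.+2 = (2 - mu) * s n.+1 - s n by rewrite -rec addrK.
by ring.
Qed.

(** * Jet costs of a competitor compared with those of a geodesic *)

(** The step-size hypothesis lets the part of the cubic difference that is quadratic in [zeta] be
    absorbed by [c * zeta^2]. What remains is linear in [W] and [zeta], with small coefficients of
    order [e^3] and [e^2]. *)
Lemma kl_jet_diff_ge (R : realType) (m c e W X Y S T : R) :
  0 < m -> m <= X -> m <= Y -> m <= S -> m <= T -> `|S - T| <= e ->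
  `|X - S| <= W -> `|Y - T| <= W ->
  `|X - Y| + 2 * `|S - T| <= 3 / 2 * c * m ->
  2 * ((X - Y) ^+ 2 - (S - T) ^+ 2) - c * ((X - S) - (Y - T)) ^+ 2 -
    (2 / 3 * e ^+ 3 / m ^+ 2 * W + 2 * e ^+ 2 / m * `|(X - S) - (Y - T)|)
  <= kl_jet X Y - kl_jet S T.
Proof.
move=> m0 mX mY mS mT hs hX hY hd.
have e0 : 0 <= e by exact: le_trans (normr_ge0 _) hs.
have W0 : 0 <= W by exact: le_trans (normr_ge0 _) hX.
set zeta := (X - S) - (Y - T); set sigma := S - T; set delta := X - Y.
have XY0 : 0 < X + Y by lra.
have ST0 : 0 < S + T by lra.
(* As [delta = sigma + zeta], the cubes differ by [zeta^2 (delta + 2 sigma) + 3 sigma^2 zeta]; the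
   last term accounts for the change of denominator. *)
have -> : kl_jet X Y - kl_jet S T = 2 * (delta ^+ 2 - sigma ^+ 2) +
   4 / 3 * (zeta ^+ 2 * (delta + 2 * sigma) / (X + Y)
          + 3 * sigma ^+ 2 * zeta / (X + Y)
          + sigma ^+ 3 * ((S - X) + (T - Y)) / ((X + Y) * (S + T))).
  by rewrite /kl_jet /zeta /sigma /delta; field; rewrite !lt0r_neq0.
have i1 : 0 <= (X + Y)^-1 <= (2 * m)^-1.
  by rewrite invr_ge0 ltW //= lef_pV2 ?posrE //; lra.
have i2 : 0 <= ((X + Y) * (S + T))^-1 <= (4 * m ^+ 2)^-1.
  rewrite invr_ge0 ltW ?mulr_gt0 //= lef_pV2 ?posrE ?mulr_gt0 ?exprn_gt0 //.
  nra.
have t1 : - (3 / 4 * c * zeta ^+ 2) <= zeta ^+ 2 * (delta + 2 * sigma) / (X + Y).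
  have h : `|delta + 2 * sigma| <= 3 / 2 * c * m.
    apply: le_trans hd; apply: le_trans (ler_normD _ _) _.
    by rewrite normrM (@ger0_norm _ 2).
  have z2 := sqr_ge0 zeta.
  rewrite -mulrA -mulNr mulrC mulrN -mulNr [leRHS]mulrC.
  have : `|(delta + 2 * sigma) / (X + Y)| <= 3 / 4 * c.
    rewrite normrM (@ger0_norm _ (X + Y)^-1) ?(andP i1).1 //.
    apply: le_trans (_ : 3 / 2 * c * m * (2 * m)^-1 <= _).
      by apply: ler_pM => //; have /andP[] := i1.
    by rewrite le_eqVlt; apply/orP; left; apply/eqP; field; rewrite lt0r_neq0.
  rewrite ler_norml => /andP[h1 _]; nra.
have t2 : - (3 / 2 * e ^+ 2 / m * `|zeta|) <= 3 * sigma ^+ 2 * zeta / (X + Y).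
  have : `|3 * sigma ^+ 2 * zeta / (X + Y)| <= 3 / 2 * e ^+ 2 / m * `|zeta|.
    have -> : 3 / 2 * e ^+ 2 / m * `|zeta| = 3 * e ^+ 2 * `|zeta| * (2 * m)^-1.
      by field; rewrite lt0r_neq0.
    rewrite normrM (normrM _ zeta) (normrM 3) normrX (@ger0_norm _ 3) //.
    rewrite (@ger0_norm _ (X + Y)^-1) ?(andP i1).1 //.
    have s2 : `|sigma| ^+ 2 <= e ^+ 2 by apply: lerXn2r; rewrite ?nnegrE.
    apply: ler_pM => //; rewrite ?mulr_ge0 ?exprn_ge0 //; try by case/andP: i1.
    by rewrite !ler_wpM2r // ler_wpM2l.
  by rewrite ler_norml => /andP[].
have t3 : - (1 / 2 * e ^+ 3 / m ^+ 2 * W) <=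
    sigma ^+ 3 * ((S - X) + (T - Y)) / ((X + Y) * (S + T)).
  have : `|sigma ^+ 3 * ((S - X) + (T - Y)) / ((X + Y) * (S + T))| <=
      1 / 2 * e ^+ 3 / m ^+ 2 * W.
    have -> : 1 / 2 * e ^+ 3 / m ^+ 2 * W = e ^+ 3 * (W + W) * (4 * m ^+ 2)^-1.
      by field; rewrite lt0r_neq0.
    rewrite normrM normrM (@ger0_norm _ (_ ^-1)) ?(andP i2).1 // normrX.
    have s3 : `|sigma| ^+ 3 <= e ^+ 3 by apply: lerXn2r; rewrite ?nnegrE.
    apply: ler_pM => //; rewrite ?mulr_ge0 ?exprn_ge0 //; try by case/andP: i2.
    apply: ler_pM => //; rewrite ?exprn_ge0 //.
    by apply: le_trans (ler_normD _ _) _; rewrite lerD // distrC.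
  by rewrite ler_norml => /andP[].
by lra.
Qed.

(* Testing a geodesic against z = x - s costs only [mu * <s, z>], and
   [2 <s, z> = |x|^2 - 1 - |z|^2 >= - |z|^2] because [|x| >= 1 = |s|]. *)
Lemma sphere_excess (R : realFieldType) (I : finType) (f : nat) (mu : R)
    (s x : nat -> I -> R) :
  (0 < f)%N -> 0 <= mu ->
  (forall k i, s k.+2 i + s k i = (2 - mu) * s k.+1 i) ->
  (forall k, (k <= f)%N -> \sum_i s k i ^+ 2 = 1) ->
  (forall k, (k <= f)%N -> 1 <= \sum_i x k i ^+ 2) ->
  x 0%N =1 s 0%N -> x f =1 s f ->
  (1 - mu * f%:R ^+ 2 / 4) * \sum_i \sum_(0 <= k < f)
     ((x k.+1 i - s k.+1 i) - (x k i - s k i)) ^+ 2 <=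
  \sum_i \sum_(0 <= k < f)
     ((x k.+1 i - x k i) ^+ 2 - (s k.+1 i - s k i) ^+ 2).
Proof.
move=> f0 mu0 rec s1 x1 x0 xf.
pose z k i := x k i - s k i.
pose Q i := \sum_(0 <= k < f) (z k.+1 i - z k i) ^+ 2.
(* Each [|z k i|] is at most half the variation, whose square is at most [f * Q i]; adding [f] such
   terms gives the factor [f^2 / 4]. *)
have poincare i : \sum_(0 <= k < f) z k i ^+ 2 <= f%:R ^+ 2 / 4 * Q i.
  pose V : R := \sum_(0 <= k < f) `|z k.+1 i - z k i|.
  have VQ : V ^+ 2 <= f%:R * Q i.
    apply: le_trans (sqr_sum_le _ _) _; rewrite ler_wpM2l //.
    by apply: ler_sum => k _; rewrite real_normK ?num_real.
  apply: le_trans (_ : \sum_(0 <= k < f) V ^+ 2 / 4 <= _).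
    rewrite !big_mkord; apply: ler_sum => k _.
    have h : 2 * `|z k i| <= V.
      apply: (norm_le_variation (z := fun k => z k i)).
      - by rewrite /z x0 subrr.
      - by rewrite /z xf subrr.
      - exact: ltnW.
    have := lerXn2r 2 _ _ h; rewrite !nnegrE exprMn real_normK ?num_real //.
    have V0 : 0 <= V by apply: sumr_ge0.
    by move=> /(_ _ V0); rewrite mulr_ge0 // => /(_ isT) h2; lra.
  rewrite sumr_const_nat subn0 -mulr_natl.
  have : f%:R * V ^+ 2 <= f%:R * (f%:R * Q i) by rewrite ler_wpM2l.
  lra.
have abel i : \sum_(0 <= k < f) (s k.+1 i - s k i) * (z k.+1 i - z k i) =
    mu * \sum_(0 <= k < f) s k i * z k i.
  have zf : z f i = 0 by rewrite /z xf subrr.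
  case: f f0 zf {s1 x1 xf Q poincare} => // n _ zf.
  rewrite (@abel_sum _ mu (fun k => s k i) (fun k => z k i)) // ?zf ?mulr0 ?add0r //.
  by rewrite /z x0 subrr.
have inner : - (\sum_i \sum_(0 <= k < f) z k i ^+ 2) <=
    2 * \sum_i \sum_(0 <= k < f) s k i * z k i.
  rewrite (exchange_big_dep predT) //= [in leRHS](exchange_big_dep predT) //=.
  rewrite big_distrr -sumrN /= !big_mkord; apply: ler_sum => k _.
  have kf : (k <= f)%N by exact: ltnW.
  have := x1 k kf; have := s1 k kf.
  have -> : \sum_i x k i ^+ 2 =
      \sum_i s k i ^+ 2 + 2 * \sum_i s k i * z k i + \sum_i z k i ^+ 2.
    rewrite big_distrr -!big_split /=; apply: eq_bigr => i _.
    by rewrite /z; ring.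
  by move=> ->; lra.
(* Expand [|ds + dz|^2 - |ds|^2] and convert the cross term by [abel]. *)
have -> : \sum_i \sum_(0 <= k < f)
     ((x k.+1 i - x k i) ^+ 2 - (s k.+1 i - s k i) ^+ 2) =
   \sum_i Q i + mu * (2 * \sum_i \sum_(0 <= k < f) s k i * z k i).
  rewrite mulrCA !big_distrr /= -big_split /=; apply: eq_bigr => i _.
  rewrite -abel big_distrr -big_split /=; apply: eq_bigr => k _.
  by rewrite /z; ring.
have : \sum_i \sum_(0 <= k < f) z k i ^+ 2 <= f%:R ^+ 2 / 4 * \sum_i Q i.
  by rewrite big_distrr /=; apply: ler_sum.
move=> h.
have : mu * - (f%:R ^+ 2 / 4 * \sum_i Q i) <=
    mu * (2 * \sum_i \sum_(0 <= k < f) s k i * z k i).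
  by apply: ler_wpM2l => //; lra.
set A := \sum_i Q i; set B := mu * (2 * _).
lra.
Qed.

(** The quadratic excess supplies [2 c * Q]. One copy of [c * Q] pays for the cubic terms, the other
    for completing the square against the terms linear in the variation. *)
Lemma kl_jet_sum_ge (R : realType) (I : finType) (f : nat) (mu m D c : R)
    (s x : nat -> I -> R) :
  (0 < f)%N -> 0 < m -> 0 < c -> 0 <= mu -> c <= 1 - mu * f%:R ^+ 2 / 4 ->
  (forall k i, s k.+2 i + s k i = (2 - mu) * s k.+1 i) ->
  (forall k, (k <= f)%N -> \sum_i s k i ^+ 2 = 1) ->
  (forall k, (k <= f)%N -> 1 <= \sum_i x k i ^+ 2) ->
  (forall k i, (k <= f)%N -> m <= s k i) ->
  (forall k i, (k <= f)%N -> m <= x k i) ->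
  x 0%N =1 s 0%N -> x f =1 s f ->
  (forall k i, (k < f)%N -> `|s k.+1 i - s k i| <= D / f%:R) ->
  (forall k i, (k < f)%N ->
     `|x k.+1 i - x k i| + 2 * `|s k.+1 i - s k i| <= 3 / 2 * c * m) ->
  - (#|I|%:R * (2 / 3 * D ^+ 3 / m ^+ 2 + 2 * D ^+ 2 / m) ^+ 2 / (4 * c)
      / f%:R ^+ 3) <=
  \sum_i \sum_(0 <= k < f)
    (kl_jet (x k.+1 i) (x k i) - kl_jet (s k.+1 i) (s k i)).
Proof.
move=> f0 m0 c0 mu0 hc rec s1 x1 sm xm x0 xf hs hx.
have fR : 0 < f%:R :> R by rewrite ltr0n.
have fn0 : f%:R != 0 :> R by exact: lt0r_neq0.
pose z k i := x k i - s k i.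
pose V i : R := \sum_(0 <= k < f) `|z k.+1 i - z k i|.
pose Q i := \sum_(0 <= k < f) (z k.+1 i - z k i) ^+ 2.
pose S i := \sum_(0 <= k < f)
     ((x k.+1 i - x k i) ^+ 2 - (s k.+1 i - s k i) ^+ 2).
(* The two linear errors, summed over the steps with [e = D / f]; both scale as [f^-2]. *)
pose E := 2 / 3 * D ^+ 3 / m ^+ 2 + 2 * D ^+ 2 / m.
have V0 i : 0 <= V i by apply: sumr_ge0.
have VQ i : V i ^+ 2 <= f%:R * Q i.
  apply: le_trans (sqr_sum_le _ _) _; rewrite ler_wpM2l //.
  by apply: ler_sum => k _; rewrite real_normK ?num_real.
have zV i k : (k <= f)%N -> `|z k i| <= V i.
  move=> kf; have : 2 * `|z k i| <= V i.
    apply: (norm_le_variation (z := fun k => z k i)) => //.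
    - by rewrite /z x0 subrr.
    - by rewrite /z xf subrr.
  by have := normr_ge0 (z k i); lra.
have step i : 2 * S i - c * Q i - E / f%:R ^+ 2 * V i <=
    \sum_(0 <= k < f) (kl_jet (x k.+1 i) (x k i) - kl_jet (s k.+1 i) (s k i)).
  pose e := D / f%:R.
  have -> : 2 * S i - c * Q i - E / f%:R ^+ 2 * V i =
    \sum_(0 <= k < f) (2 * ((x k.+1 i - x k i) ^+ 2 - (s k.+1 i - s k i) ^+ 2)
      - c * (z k.+1 i - z k i) ^+ 2
      - (2 / 3 * e ^+ 3 / m ^+ 2 * V i + 2 * e ^+ 2 / m * `|z k.+1 i - z k i|)).
    rewrite !sumrB big_split /= -!big_distrr /= -/(S i) -/(Q i) -/(V i).
    rewrite sumr_const_nat subn0 -mulr_natl /E /e; field.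
    by rewrite fn0 lt0r_neq0.
  rewrite !big_mkord; apply: ler_sum => k _.
  have kf := ltn_ord k.
  by apply: kl_jet_diff_ge => //; rewrite ?hs ?hx ?zV ?xm ?sm // ltnW.
have bound i : - (E ^+ 2 / (4 * c) / f%:R ^+ 3) <= c * Q i - E / f%:R ^+ 2 * V i.
  have h : V i ^+ 2 / f%:R <= Q i by rewrite ler_pdivrMr // mulrC.
  have : c * (V i ^+ 2 / f%:R) <= c * Q i by rewrite ler_wpM2l // ltW.
  (* The square is centred at the minimizer in [V i] of [c * V^2 / f - E * V / f^2]. *)
  have : 0 <= c / f%:R * (V i - E / (2 * c * f%:R)) ^+ 2.
    by rewrite mulr_ge0 ?sqr_ge0 // divr_ge0 // ltW.
  have -> : c / f%:R * (V i - E / (2 * c * f%:R)) ^+ 2 =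
     c * (V i ^+ 2 / f%:R) - E / f%:R ^+ 2 * V i + E ^+ 2 / (4 * c) / f%:R ^+ 3.
    by field; rewrite fn0 lt0r_neq0.
  lra.
have excess : c * \sum_i Q i <= \sum_i S i.
  apply: le_trans (sphere_excess f0 mu0 rec s1 x1 x0 xf).
  apply: ler_wpM2r => //; apply: sumr_ge0 => i _; apply: sumr_ge0 => k _.
  exact: sqr_ge0.
apply: le_trans (_ : \sum_i (2 * S i - c * Q i - E / f%:R ^+ 2 * V i) <= _); last first.
  by apply: ler_sum.
apply: le_trans (_ : \sum_i (c * Q i - E / f%:R ^+ 2 * V i) <= _).
  have : \sum_(i : I) - (E ^+ 2 / (4 * c) / f%:R ^+ 3) <=
      \sum_i (c * Q i - E / f%:R ^+ 2 * V i) by apply: ler_sum.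
  rewrite sumr_const -[leLHS]mulr_natl mulrN.
  by rewrite -/E !mulrA.
rewrite !sumrB -!big_distrr /=; lra.
Qed.

(** * Trigonometry of great-circle arcs *)

Lemma sin_dist_le (R : realType) (a b : R) : `|sin a - sin b| <= `|a - b|.
Proof.
wlog ab : a b / b < a.
  move=> H; case: (ltgtP a b) => [lt|lt|->]; last by rewrite !subrr.
    by rewrite distrC [leRHS]distrC; exact: H.
  exact: H.
have der (x : R) : x \in `]b, a[ -> is_derive x 1 (@sin R) (cos x).
  by move=> _; exact: is_derive_sin.
have [|c _ ->] := MVT ab der.
  by apply: continuous_subspaceT => x; exact: continuous_sin.
rewrite normrM -[leRHS]mul1r ler_wpM2r //.
by rewrite ler_norml cos_geN1 cos_le1.
Qed.

(** This quantity is the [mu] of the SLERP recurrence; it equals [4 sin^2 (h / 2)]. *)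
Lemma versine_bound (R : realType) (h : R) : 0 <= 2 - 2 * cos h <= h ^+ 2.
Proof.
have := cos_le1 h => c1; apply/andP; split; first lra.
have -> : 2 - 2 * cos h = 4 * sin (h / 2) ^+ 2.
  have -> : cos h = cos (h / 2 + h / 2) by congr cos; lra.
  by rewrite cosD -!expr2 cos2sin2; ring.
have := sin_dist_le (h / 2) 0; rewrite sin0 !subr0 => hs.
have := lerXn2r 2 _ _ hs; rewrite !nnegrE !real_normK ?num_real //.
by move=> /(_ (normr_ge0 _) (normr_ge0 _)) h2; lra.
Qed.

Definition arc (R : realType) (Om a b t : R) : R :=
  sin ((1 - t) * Om) / sin Om * a + sin (t * Om) / sin Om * b.

Lemma arc0 (R : realType) (Om a b : R) : sin Om != 0 -> arc Om a b 0 = a.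
Proof. by move=> h; rewrite /arc subr0 mul0r mul1r sin0 divff // mul0r mul0r mul1r addr0. Qed.

Lemma arc1 (R : realType) (Om a b : R) : sin Om != 0 -> arc Om a b 1 = b.
Proof. by move=> h; rewrite /arc subrr mul0r mul1r sin0 divff // mul0r mul0r mul1r add0r. Qed.

Lemma arc_rec (R : realType) (Om a b t h : R) :
  arc Om a b (t + h) + arc Om a b (t - h) = 2 * cos (h * Om) * arc Om a b t.
Proof.
have e1 : (1 - (t + h)) * Om = (1 - t) * Om - h * Om by ring.
have e2 : (1 - (t - h)) * Om = (1 - t) * Om + h * Om by ring.
have e3 : (t + h) * Om = t * Om + h * Om by ring.
have e4 : (t - h) * Om = t * Om - h * Om by ring.
rewrite /arc e1 e2 e3 e4 !sinB !sinD; ring.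
Qed.

Lemma arc_ge0 (R : realType) (Om a b t : R) :
  0 < Om <= pi -> 0 < sin Om -> 0 <= a -> 0 <= b -> 0 <= t <= 1 -> 0 <= arc Om a b t.
Proof.
move=> /andP[Om0 Ompi] s0 a0 b0 /andP[t0 t1].
by apply: addr_ge0; apply: mulr_ge0 => //; (apply: divr_ge0; last exact: ltW);
  apply: sin_ge0_pi; apply/andP; split; nra.
Qed.

Lemma arc_dist_le (R : realType) (Om a b t t' : R) :
  0 <= Om -> 0 < sin Om -> 0 <= a <= 1 -> 0 <= b <= 1 ->
  `|arc Om a b t' - arc Om a b t| <= 2 * Om / sin Om * `|t' - t|.
Proof.
move=> Om0 s0 /andP[a0 a1] /andP[b0 b1].
have -> : arc Om a b t' - arc Om a b t =
   (sin ((1 - t') * Om) - sin ((1 - t) * Om)) / sin Om * a +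
   (sin (t' * Om) - sin (t * Om)) / sin Om * b by rewrite /arc; ring.
have h1 : `|sin ((1 - t') * Om) - sin ((1 - t) * Om)| <= `|t' - t| * Om.
  apply: le_trans (sin_dist_le _ _) _.
  have -> : (1 - t') * Om - (1 - t) * Om = - ((t' - t) * Om) by ring.
  by rewrite normrN normrM (ger0_norm Om0).
have h2 : `|sin (t' * Om) - sin (t * Om)| <= `|t' - t| * Om.
  apply: le_trans (sin_dist_le _ _) _.
  by rewrite -mulrBl normrM (ger0_norm Om0).
have -> : 2 * Om / sin Om * `|t' - t| =
   `|t' - t| * Om / sin Om * 1 + `|t' - t| * Om / sin Om * 1 by ring.
apply: le_trans (ler_normD _ _) _.
have term (d c : R) : `|d| <= `|t' - t| * Om -> 0 <= c <= 1 ->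
    `|d / sin Om * c| <= `|t' - t| * Om / sin Om * 1.
  move=> hd /andP[c0 c1].
  have i0 : 0 <= (sin Om)^-1 by rewrite invr_ge0 ltW.
  rewrite normrM normrM (ger0_norm i0) (ger0_norm c0).
  by apply: ler_pM => //; [rewrite mulr_ge0 | rewrite ler_wpM2r].
by apply: lerD; apply: term => //; apply/andP.
Qed.

(** With [x + y = Om], the claim reduces to [sin^2 x + 2 sin x sin y cos (x + y) + sin^2 y = sin^2
    (x + y)]. *)
Lemma arc_unit (R : realType) (I : finType) (Om : R) (a b : I -> R) (t : R) :
  sin Om != 0 -> \sum_i a i ^+ 2 = 1 -> \sum_i b i ^+ 2 = 1 ->
  \sum_i a i * b i = cos Om -> \sum_i arc Om (a i) (b i) t ^+ 2 = 1.
Proof.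
move=> s0 a1 b1 ab; set x := (1 - t) * Om; set y := t * Om.
have -> : \sum_i arc Om (a i) (b i) t ^+ 2 =
    (sin x / sin Om) ^+ 2 * \sum_i a i ^+ 2 +
    2 * (sin x / sin Om) * (sin y / sin Om) * \sum_i a i * b i +
    (sin y / sin Om) ^+ 2 * \sum_i b i ^+ 2.
  rewrite !big_distrr -!big_split /=; apply: eq_bigr => i _.
  by rewrite /arc -/x -/y; ring.
rewrite a1 b1 ab.
have eO : Om = x + y by rewrite /x /y; ring.
have -> : (sin x / sin Om) ^+ 2 * 1 + 2 * (sin x / sin Om) * (sin y / sin Om) * cos Om
    + (sin y / sin Om) ^+ 2 * 1 =
    (sin x ^+ 2 + 2 * sin x * sin y * cos Om + sin y ^+ 2) / sin Om ^+ 2.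
  by field.
have -> : sin x ^+ 2 + 2 * sin x * sin y * cos Om + sin y ^+ 2 = sin Om ^+ 2.
  rewrite eO sinD cosD.
  have hx := cos2Dsin2 x; have hy := cos2Dsin2 y.
  have cx : cos x ^+ 2 = 1 - sin x ^+ 2 by rewrite -hx addrK.
  have cy : cos y ^+ 2 = 1 - sin y ^+ 2 by rewrite -hy addrK.
  by ring: cx cy.
by rewrite divff // expf_neq0.
Qed.

(** * Path costs and their infimum *)

Lemma path_costE (R : realType) (N f : nat) (w : nat -> 'rV[R]_N) :
  path_cost f w = \sum_(0 <= k < f) KL (w k.+1) (w k).
Proof. by rewrite /path_cost big_add1. Qed.

Lemma KL_ge0 (R : realType) (N : nat) (p q : 'rV[R]_N) :
  simplex p -> simplex q -> 0 <= KL p q.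
Proof.
move=> hp hq; rewrite KL_sqrt //; apply: sumr_ge0 => i _.
by apply: sqrt_kl_ge0; rewrite sqrtr_gt0; [apply: hp.1 | apply: hq.1].
Qed.

Lemma path_cost_ge0 (R : realType) (N f : nat) (u v : 'rV[R]_N) w :
  is_path u v f w -> 0 <= path_cost f w.
Proof.
move=> [_ _ hw]; rewrite path_costE big_mkord; apply: sumr_ge0 => k _.
by apply: KL_ge0; apply: hw => //; exact: ltnW.
Qed.

Lemma C_star_le (R : realType) (N f : nat) (u v : 'rV[R]_N) w :
  is_path u v f w -> C_star u v f <= path_cost f w.
Proof.
move=> hw; apply: ge_inf; last by exists w.
by exists 0 => _ [w' hw' <-]; exact: path_cost_ge0 hw'.
Qed.

Lemma sqrt_simplex (R : realType) (N : nat) (u : 'rV[R]_N) : simplex u ->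
  \sum_i Num.sqrt (u 0 i) ^+ 2 = 1.
Proof.
by move=> [u0 <-]; apply: eq_bigr => i _; rewrite sqr_sqrtr // ltW.
Qed.

Lemma simplex_le1 (R : realType) (N : nat) (u : 'rV[R]_N) i : simplex u -> u 0 i <= 1.
Proof.
move=> [u0 <-]; rewrite (bigD1 i) //= lerDl.
by apply: sumr_ge0 => j _; exact: ltW.
Qed.

(** * The angle between the endpoints and the SLERP path *)

Section Endpoints.
Variables (R : realType) (N : nat) (u v : 'rV[R]_N).
Hypotheses (hu : simplex u) (hv : simplex v).

Definition bhattacharyya : R := \sum_i Num.sqrt (u 0 i) * Num.sqrt (v 0 i).

Lemma chord_sqr :
  \sum_i (Num.sqrt (v 0 i) - Num.sqrt (u 0 i)) ^+ 2 = 2 - 2 * bhattacharyya.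
Proof.
have -> : (2 : R) - 2 * bhattacharyya = \sum_i Num.sqrt (v 0 i) ^+ 2 +
   \sum_i Num.sqrt (u 0 i) ^+ 2 - 2 * bhattacharyya.
  by rewrite !sqrt_simplex //; ring.
rewrite /bhattacharyya big_distrr -big_split -sumrB /=; apply: eq_bigr => i _.
ring.
Qed.

Lemma sum_sqrt_prod : \sum_i Num.sqrt (u 0 i * v 0 i) = bhattacharyya.
Proof. by rewrite /bhattacharyya; apply: eq_bigr => i _; rewrite sqrtrM // ltW // hu.1. Qed.

Lemma bhattacharyya_bounds : 0 <= bhattacharyya <= 1.
Proof.
apply/andP; split.
  by apply: sumr_ge0 => i _; rewrite mulr_ge0 ?sqrtr_ge0.
have : 0 <= \sum_i (Num.sqrt (v 0 i) - Num.sqrt (u 0 i)) ^+ 2.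
  by apply: sumr_ge0 => i _; exact: sqr_ge0.
rewrite chord_sqr; lra.
Qed.

Lemma cos_Omega : cos (Omega u v) = bhattacharyya.
Proof.
rewrite /Omega sum_sqrt_prod acosK // in_itv /=.
by have /andP[h0 h1] := bhattacharyya_bounds; apply/andP; split; lra.
Qed.

(** The cosine of the angle is nonnegative, whereas an angle between 2 and [pi] exceeds [pi / 2] and
    has negative cosine. *)
Lemma Omega_bounds : 0 <= Omega u v < 2.
Proof.
have /andP[h0 h1] := bhattacharyya_bounds.
have BCI : -1 <= bhattacharyya <= 1 by apply/andP; split; lra.
have om0 : 0 <= Omega u v by rewrite /Omega sum_sqrt_prod acos_ge0.
rewrite om0 /=; have opi : Omega u v <= pi by rewrite /Omega sum_sqrt_prod acos_lepi.
have p2 := pihalf_lt2 R; have p0 := pi_gt0 R.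
case: (ltP (Omega u v) 2) => // om2.
have : 0 < sin (Omega u v - pi / 2) by apply: sin_gt0_pi; apply/andP; split; lra.
by rewrite sinBpihalf cos_Omega; lra.
Qed.

Lemma sin_Omega_gt0 : 0 < Omega u v -> 0 < sin (Omega u v).
Proof.
move=> om0; apply: sin_gt0_pi; rewrite om0 /=.
by have /andP[_ om2] := Omega_bounds; exact: lt_le_trans om2 (pi_ge2 R).
Qed.

Lemma Omega_eq0 : Omega u v = 0 -> u = v.
Proof.
move=> om0; have := chord_sqr; rewrite -cos_Omega om0 cos0 mulr1 subrr.
move/eqP; rewrite psumr_eq0 => [/allP h|i _]; last exact: sqr_ge0.
apply/rowP => i; have := h i (mem_index_enum i).
rewrite sqrf_eq0 subr_eq0 => /eqP e.
by rewrite -[LHS]sqr_sqrtr ?ltW ?hu.1 // -e sqr_sqrtr // ltW // hv.1.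
Qed.

Lemma chord_gt0 : 0 < Omega u v ->
  0 < \sum_i (Num.sqrt (v 0 i) - Num.sqrt (u 0 i)) ^+ 2.
Proof.
move=> om0; rewrite chord_sqr.
have /andP[_ b1] := bhattacharyya_bounds.
suff : bhattacharyya != 1 by move=> n1; have := lt_neqAle bhattacharyya 1; rewrite n1 b1; lra.
by apply: contraTneq om0 => e; rewrite /Omega sum_sqrt_prod e acos1 ltxx.
Qed.

Definition slerp_root (t : R) (i : 'I_N) : R :=
  arc (Omega u v) (Num.sqrt (u 0 i)) (Num.sqrt (v 0 i)) t.

Lemma slerpE t i : 0 < Omega u v -> slerp u v t 0 i = slerp_root t i ^+ 2.
Proof. by move=> om0; rewrite /slerp gt_eqF // mxE. Qed.

Lemma sqrt_slerp t i : 0 < Omega u v -> 0 <= t <= 1 ->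
  Num.sqrt (slerp u v t 0 i) = slerp_root t i.
Proof.
move=> om0 t01; rewrite slerpE // sqrtr_sqr ger0_norm //.
have /andP[_ om2] := Omega_bounds.
apply: arc_ge0; rewrite ?sqrtr_ge0 ?sin_Omega_gt0 // om0 /=.
exact: ltW (lt_le_trans om2 (pi_ge2 R)).
Qed.

Lemma slerp_root_unit t : 0 < Omega u v -> \sum_i slerp_root t i ^+ 2 = 1.
Proof.
move=> om0; apply: arc_unit; rewrite ?sqrt_simplex ?cos_Omega //.
by rewrite lt0r_neq0 ?sin_Omega_gt0.
Qed.

Lemma slerp_simplex t : (forall i, 0 < slerp u v t 0 i) -> simplex (slerp u v t).
Proof.
move=> h; split=> //; have /andP[om0 _] := Omega_bounds.
case: (eqVneq (Omega u v) 0) => [e|n].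
  by rewrite /slerp e eqxx; exact: hu.2.
have op : 0 < Omega u v by rewrite lt_neqAle eq_sym n.
by rewrite -(slerp_root_unit t op); apply: eq_bigr => i _; rewrite slerpE.
Qed.

Lemma slerp0 : slerp u v 0 = u.
Proof.
have /andP[om0 _] := Omega_bounds; rewrite /slerp; case: eqP => // /eqP n.
have op : 0 < Omega u v by rewrite lt_neqAle eq_sym n.
apply/rowP => i; rewrite mxE -/(arc _ _ _ _) arc0 ?lt0r_neq0 ?sin_Omega_gt0 //.
by rewrite sqr_sqrtr // ltW // hu.1.
Qed.

Lemma slerp1 : slerp u v 1 = v.
Proof.
have /andP[om0 _] := Omega_bounds; rewrite /slerp; case: eqP => [/Omega_eq0//|/eqP n].
have op : 0 < Omega u v by rewrite lt_neqAle eq_sym n.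
apply/rowP => i; rewrite mxE -/(arc _ _ _ _) arc1 ?lt0r_neq0 ?sin_Omega_gt0 //.
by rewrite sqr_sqrtr // ltW // hv.1.
Qed.

Lemma slerp_is_path (f : nat) : (0 < f)%N ->
  (forall t : R, 0 <= t <= 1 -> forall i, 0 < slerp u v t 0 i) ->
  is_path u v f (fun k => slerp u v (k%:R / f%:R)).
Proof.
move=> f0 h; have fR : 0 < f%:R :> R by rewrite ltr0n.
split; first by rewrite mul0r slerp0.
  by rewrite divff ?slerp1 // lt0r_neq0.
move=> k kf; apply: slerp_simplex; apply: h.
by rewrite divr_ge0 //= ler_pdivrMr // mul1r ler_nat.
Qed.

End Endpoints.

(** * Near-optimality of SLERP for distinct endpoints *)

(** Meant for [a] of order [1/f] and a fixed cost [q]: the deficit is positive only if [a > q], and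
    then the factor [(a / q)^2 >= 1] turns [a] into a term of order [f^-3]. *)
Lemma le_cube_of_gt (R : realFieldType) (a q : R) : 0 <= a -> 0 < q ->
  a - q <= a ^+ 3 / q ^+ 2.
Proof.
move=> a0 q0; rewrite ler_pdivlMr ?exprn_gt0 //.
case: (leP a q) => aq.
  have : 0 <= a ^+ 3 by exact: exprn_ge0.
  have : 0 <= q ^+ 2 by exact: sqr_ge0.
  nra.
have : q ^+ 2 <= a ^+ 2 by apply: lerXn2r; rewrite ?nnegrE // ltW.
have : 0 <= q ^+ 3 by exact: exprn_ge0 (ltW q0).
move=> q3 q2; have : a * q ^+ 2 <= a * a ^+ 2 by exact: ler_wpM2l.
by rewrite (exprS a) mulrBl -exprS; lra.
Qed.

Section NearOptimality.
Variables (R : realType) (N : nat) (eps : R) (u v : 'rV[R]_N).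
Hypotheses (heps : 0 < eps) (hu : simplex u) (hv : simplex v).
Hypothesis hmin : forall t : R, 0 <= t <= 1 -> forall i, eps <= slerp u v t 0 i.
Hypothesis Om_gt0 : 0 < Omega u v.

(** [m] is the floor for square roots, [D / f] bounds a SLERP step, [c] is what the Poincare
    inequality leaves, [kappa] is the step size allowed in [kl_jet_diff_ge], and [C / f] bounds the
    SLERP cost. *)
Let m : R := Num.sqrt eps.
Let D : R := 2 * Omega u v / sin (Omega u v).
Let c : R := 1 - Omega u v ^+ 2 / 4.
Let kappa : R := 3 / 2 * c * m.
Let C : R := 3 / m * D ^+ 2 * N%:R.
Let s (f k : nat) (i : 'I_N) : R := slerp_root u v (k%:R / f%:R) i.

Local Lemma m_gt0 : 0 < m. Proof. by rewrite sqrtr_gt0. Qed.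

Local Lemma D_gt0 : 0 < D.
Proof. by rewrite divr_gt0 ?mulr_gt0 ?sin_Omega_gt0. Qed.

Local Lemma c_gt0 : 0 < c.
Proof.
have /andP[om0 om2] := Omega_bounds hu hv.
have : Omega u v ^+ 2 < 4 by rewrite expr2; nra.
rewrite /c; lra.
Qed.

Local Lemma time_itv (f k : nat) : (0 < f)%N -> (k <= f)%N ->
  0 <= (k%:R / f%:R : R) <= 1.
Proof.
move=> f0 kf; rewrite divr_ge0 //= ler_pdivrMr ?ltr0n // mul1r ler_nat //.
Qed.

Local Lemma s_bounds (f k : nat) i : (0 < f)%N -> (k <= f)%N -> m <= s f k i <= 1.
Proof.
move=> f0 kf; have t01 := time_itv f0 kf.
have sl0 j : 0 < slerp u v (k%:R / f%:R) 0 j by exact: lt_le_trans heps (hmin t01 j).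
rewrite /s -sqrt_slerp //; apply/andP; split; first by rewrite /m ler_wsqrtr ?hmin.
by have := ler_wsqrtr (simplex_le1 i (slerp_simplex hu hv sl0)); rewrite sqrtr1.
Qed.

Local Lemma s_step (f k : nat) i : (0 < f)%N -> `|s f k.+1 i - s f k i| <= D / f%:R.
Proof.
move=> f0; have fR : 0 < f%:R :> R by rewrite ltr0n.
have b01 (w : 'rV[R]_N) : simplex w -> 0 <= Num.sqrt (w 0 i) <= 1.
  by move=> hw; rewrite sqrtr_ge0; have := ler_wsqrtr (simplex_le1 i hw); rewrite sqrtr1.
apply: le_trans (arc_dist_le _ _ _ _ _ _) _.
- exact: ltW.
- exact: sin_Omega_gt0.
- exact: b01.
- exact: b01.
- by rewrite -mulrBl -[k.+1%:R]natr1 addrAC subrr add0r mul1r ger0_norm // invr_ge0 ltW.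
Qed.

Local Lemma C_SLERP_E (f : nat) : (0 < f)%N ->
  C_SLERP u v f = \sum_i \sum_(0 <= k < f) sqrt_kl (s f k.+1 i) (s f k i).
Proof.
move=> f0; rewrite /C_SLERP path_costE [RHS]exchange_big /= !big_mkord.
apply: eq_bigr => k _; have kf := ltn_ord k.
have sl j : (j <= f)%N -> simplex (slerp u v (j%:R / f%:R)).
  move=> jf; apply: slerp_simplex => // i.
  exact: lt_le_trans heps (hmin (time_itv f0 jf) i).
rewrite /= (KL_sqrt (sl _ kf) (sl _ (ltnW kf))); apply: eq_bigr => i _.
by rewrite !sqrt_slerp // time_itv // ltnW.
Qed.

Local Lemma C_SLERP_le (f : nat) : (0 < f)%N -> C_SLERP u v f <= C / f%:R.
Proof.
move=> f0; have fR : 0 < f%:R :> R by rewrite ltr0n.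
rewrite C_SLERP_E //.
apply: le_trans (_ : \sum_(i < N) \sum_(0 <= k < f) 3 / m * (D / f%:R) ^+ 2 <= _).
  apply: ler_sum => i _; rewrite !big_mkord; apply: ler_sum => k _.
  have /andP[s1 s2] := s_bounds i f0 (ltn_ord k).
  apply: le_trans (sqrt_kl_le m_gt0 _ s2 (s_bounds i f0 (ltnW (ltn_ord k)))) _.
    exact: lt_le_trans m_gt0 s1.
  apply: ler_wpM2l; first by rewrite divr_ge0 // ltW // m_gt0.
  rewrite -[leLHS]real_normK ?num_real //.
  by apply: lerXn2r; rewrite ?nnegrE ?s_step // divr_ge0 // ltW // D_gt0.
rewrite sumr_const sumr_const_nat subn0 card_ord -mulrnA -[leLHS]mulr_natl natrM /C.
rewrite le_eqVlt; apply/orP; left; apply/eqP; field.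
by rewrite !lt0r_neq0 // m_gt0.
Qed.

(** Each coordinate covers a fixed displacement in [f] steps, so by Cauchy-Schwarz its squared steps
    sum to at least the squared displacement over [f]. *)
Local Lemma C_SLERP_ge (f : nat) : (0 < f)%N ->
  2 / 3 * (\sum_i (Num.sqrt (v 0 i) - Num.sqrt (u 0 i)) ^+ 2) / f%:R <= C_SLERP u v f.
Proof.
move=> f0; have fR : 0 < f%:R :> R by rewrite ltr0n.
rewrite C_SLERP_E // big_distrr big_distrl /=; apply: ler_sum => i _.
have -> : Num.sqrt (v 0 i) - Num.sqrt (u 0 i) =
    \sum_(0 <= k < f) (s f k.+1 i - s f k i).
  rewrite telescope_sumr // /s -!sqrt_slerp ?time_itv //.
  by rewrite divff ?lt0r_neq0 // mul0r slerp0 // slerp1.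
have := sqr_sum_le (fun k => s f k.+1 i - s f k i) f; set S := \sum_(0 <= k < f) _ => h.
apply: le_trans (_ : 2 / 3 * \sum_(0 <= k < f) (s f k.+1 i - s f k i) ^+ 2 <= _).
  by rewrite -mulrA ler_wpM2l // ler_pdivrMr // mulrC.
rewrite big_distrr !big_mkord; apply: ler_sum => k _ /=.
have /andP[p1 _] := s_bounds i f0 (ltn_ord k).
have /andP[p2 _] := s_bounds i f0 (ltnW (ltn_ord k)).
have p1' := lt_le_trans m_gt0 p1; have p2' := lt_le_trans m_gt0 p2.
exact: le_trans (kl_jet_ge p1' p2') (kl_jet_le p1' p2').
Qed.

Lemma slerp_near_optimal : exists A : R, 0 <= A /\
  forall (f : nat) w, (0 < f)%N -> is_path u v f w ->
    C_SLERP u v f - A / f%:R ^+ 3 <= path_cost f w.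
Proof.
(* [A1] covers the main case, adding the completed square to the fourth-order jet error; [A2] covers
   small [f], and [A3] paths with a long step. *)
pose A1 := N%:R * (2 / 3 * D ^+ 3 / m ^+ 2 + 2 * D ^+ 2 / m) ^+ 2 / (4 * c)
  + N%:R * (D ^+ 4 / (2 * m ^+ 7)).
pose A2 := C * (4 * D / kappa) ^+ 2.
pose A3 := C ^+ 3 / (kappa ^+ 2 / 6) ^+ 2.
have m0 := m_gt0; have D0 := D_gt0; have c0 := c_gt0.
have k0 : 0 < kappa by rewrite /kappa !mulr_gt0.
have C0 : 0 <= C.
  apply: mulr_ge0 => //; apply: mulr_ge0; last exact: exprn_ge0 (ltW D0).
  by rewrite divr_ge0 // ltW.
have A10 : 0 <= A1.
  apply: addr_ge0; last first.
    apply: mulr_ge0 => //; apply: divr_ge0; first exact: exprn_ge0 (ltW D0).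
    by apply: mulr_ge0 => //; exact: exprn_ge0 (ltW m0).
  apply: divr_ge0; first by apply: mulr_ge0 => //; exact: sqr_ge0.
  by apply: mulr_ge0 => //; exact: ltW.
have A20 : 0 <= A2 by apply: mulr_ge0 => //; exact: sqr_ge0.
have A30 : 0 <= A3 by apply: divr_ge0; [exact: exprn_ge0 | exact: sqr_ge0].
exists (A1 + A2 + A3); split; first by apply: addr_ge0 => //; exact: addr_ge0.
move=> f w f0 hw; have fR : 0 < f%:R :> R by rewrite ltr0n.
have fn0 : f%:R != 0 :> R by exact: lt0r_neq0.
pose y : R := f%:R^-1; have y0 : 0 < y by rewrite invr_gt0.
have y3 : 0 <= y ^+ 3 by rewrite exprn_ge0 // ltW.
have Cf := C_SLERP_le f0; rewrite -/y in Cf.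
have pc0 := path_cost_ge0 hw.
have A1y := mulr_ge0 A10 y3; have A2y := mulr_ge0 A20 y3; have A3y := mulr_ge0 A30 y3.
have -> : (A1 + A2 + A3) / f%:R ^+ 3 = A1 * y ^+ 3 + A2 * y ^+ 3 + A3 * y ^+ 3.
  by rewrite -exprVn -/y; ring.
have [w0 wf hw1] := hw.
pose x k i := Num.max (Num.sqrt (w k 0 i)) m.
have xm k i : m <= x k i by rewrite le_max lexx orbT.
have x0 k i : 0 < x k i by exact: lt_le_trans m0 (xm k i).
have cost : \sum_i \sum_(0 <= k < f) sqrt_kl (x k.+1 i) (x k i) <= path_cost f w.
  rewrite path_costE [leLHS]exchange_big /= !big_mkord; apply: ler_sum => k _.
  have kf := ltn_ord k; have h1 := hw1 _ kf; have h2 := hw1 _ (ltnW kf).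
  rewrite KL_sqrt //; apply: ler_sum => i _.
  by apply: sqrt_kl_max; rewrite ?sqrtr_gt0 //; [apply: h1.1 | apply: h2.1].
(* For small [f] the bound [C_SLERP <= C y] already suffices. *)
case: (ltP (kappa / 2) (2 * (D * y))) => small.
  suff : C * y <= A2 * y ^+ 3 by lra.
  have -> : A2 * y ^+ 3 = C * y * (2 * (D * y) / (kappa / 2)) ^+ 2.
    by rewrite /A2; field; rewrite lt0r_neq0.
  apply: ler_peMr; first by apply: mulr_ge0 => //; exact: ltW.
  by apply: exprn_ege1; rewrite ler_pdivlMr ?divr_gt0 // mul1r ltW.
(* A single step longer than [kappa / 2] costs at least [kappa^2 / 6]. *)
have [|/pred0Pn [[k i] /= big]] := eqVneq
    #|[pred p : 'I_f * 'I_N | kappa / 2 < `|x p.1.+1 p.2 - x p.1 p.2|]| 0%N; last first.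
  have q0 : 0 < kappa ^+ 2 / 6 by rewrite divr_gt0 ?exprn_gt0.
  have cy0 : 0 <= C * y by rewrite mulr_ge0 // ltW.
  have h := le_cube_of_gt cy0 q0.
  have e : (C * y) ^+ 3 / (kappa ^+ 2 / 6) ^+ 2 = A3 * y ^+ 3.
    by rewrite /A3 exprMn mulrAC.
  suff : kappa ^+ 2 / 6 <= path_cost f w by lra.
  apply: le_trans cost; rewrite (bigD1 i) //= big_mkord (bigD1 k) //=.
  have pos j l : 0 <= sqrt_kl (x l.+1 j) (x l j) by exact: sqrt_kl_ge0.
  rewrite -addrA -[leLHS]addr0; apply: lerD; last first.
    by apply: addr_ge0; apply: sumr_ge0 => // j _; apply: sumr_ge0.
  apply: le_trans (kl_jet_le _ _) => //; apply: le_trans (kl_jet_ge _ _) => //.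
  have : (kappa / 2) ^+ 2 <= `|x k.+1 i - x k i| ^+ 2.
    by apply: lerXn2r; rewrite ?nnegrE ?divr_ge0 // ltW.
  by rewrite real_normK ?num_real //; lra.
move/card0_eq => nobig.
have hx k i : (k < f)%N -> `|x k.+1 i - x k i| <= kappa / 2.
  move=> kf; have := nobig (Ordinal kf, i).
  by rewrite !inE /= => /negbT; rewrite -leNgt.
have /andP[mu0 muO] := versine_bound (Omega u v / f%:R).
have jets := @kl_jet_sum_ge R 'I_N f (2 - 2 * cos (Omega u v / f%:R)) m D c (s f) x
  f0 m0 c0 mu0.
have {}jets : - (N%:R * (2 / 3 * D ^+ 3 / m ^+ 2 + 2 * D ^+ 2 / m) ^+ 2 / (4 * c)
      / f%:R ^+ 3) <= \sum_i \sum_(0 <= k < f)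
    (kl_jet (x k.+1 i) (x k i) - kl_jet (s f k.+1 i) (s f k i)).
  rewrite -[in N%:R](card_ord N); apply: jets.
  (* [mu * f^2 <= Omega^2] by [versine_bound]. *)
  - rewrite /c; have : (2 - 2 * cos (Omega u v / f%:R)) * f%:R ^+ 2 <=
        (Omega u v / f%:R) ^+ 2 * f%:R ^+ 2 by apply: ler_wpM2r => //; exact: sqr_ge0.
    by rewrite -exprMn divfK //; lra.
  - move=> k i; have := @arc_rec R (Omega u v) (Num.sqrt (u 0 i)) (Num.sqrt (v 0 i))
      (k.+1%:R / f%:R) (f%:R^-1).
    have -> : k.+1%:R / f%:R + f%:R^-1 = k.+2%:R / f%:R :> R.
      by rewrite -[k.+2%:R]natr1 mulrDl mul1r.
    have -> : k.+1%:R / f%:R - f%:R^-1 = k%:R / f%:R :> R.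
      by rewrite -[k.+1%:R]natr1 mulrDl mul1r addrK.
    rewrite /s /slerp_root => ->; rewrite opprB addrCA subrr addr0.
    by rewrite [f%:R^-1 * _]mulrC.
  - by move=> k _; exact: slerp_root_unit.
  - move=> k kf; rewrite -(sqrt_simplex (hw1 k kf)); apply: ler_sum => i _.
    by apply: lerXn2r; rewrite ?nnegrE ?sqrtr_ge0 ?(ltW (x0 _ _)) // le_max lexx.
  - by move=> k i kf; have /andP[] := s_bounds i f0 kf.
  - by [].
  (* The endpoints lie on the SLERP path, so their square roots are at least [m] and truncation
     fixes them. *)
  - move=> i; rewrite /x w0; have /andP[h _] := s_bounds i f0 (leq0n f).
    move: h; rewrite /s -sqrt_slerp ?time_itv // mul0r slerp0 // => h.
    exact: max_l.
  - move=> i; rewrite /x wf; have /andP[h _] := s_bounds i f0 (leqnn f).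
    move: h; rewrite /s -sqrt_slerp ?time_itv // divff // slerp1 // => h.
    exact: max_l.
  - by move=> k i _; exact: s_step.
  (* Half of [kappa] goes to the step of [x], half to twice the SLERP step. *)
  - move=> k i kf; have := hx k i kf; have := s_step k i f0; rewrite -/y -/kappa.
    by lra.
have xcost : \sum_i \sum_(0 <= k < f) kl_jet (x k.+1 i) (x k i) <= path_cost f w.
  apply: le_trans cost; apply: ler_sum => i _; apply: ler_sum => k _.
  exact: kl_jet_le.
have scost : C_SLERP u v f <= \sum_i \sum_(0 <= k < f) kl_jet (s f k.+1 i) (s f k i)
    + N%:R * (D ^+ 4 / (2 * m ^+ 7)) * y ^+ 3.
  rewrite C_SLERP_E //.
  have -> : N%:R * (D ^+ 4 / (2 * m ^+ 7)) * y ^+ 3 =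
      \sum_(i < N) \sum_(0 <= k < f) (D * y) ^+ 4 / (2 * m ^+ 7).
    rewrite sumr_const sumr_const_nat subn0 card_ord -mulrnA -[RHS]mulr_natl natrM /y.
    by field; rewrite fn0 lt0r_neq0.
  rewrite -big_split /=; apply: ler_sum => i _; rewrite -big_split !big_mkord /=.
  apply: ler_sum => k _.
  apply: le_trans (sqrt_kl_le_jet m0 (s_bounds i f0 (ltn_ord k))
    (s_bounds i f0 (ltnW (ltn_ord k)))) _.
  rewrite lerD2l; apply: ler_wpM2r.
    by rewrite invr_ge0; apply: mulr_ge0 => //; exact: exprn_ge0 (ltW m0).
  have -> : (s f k.+1 i - s f k i) ^+ 4 = `|s f k.+1 i - s f k i| ^+ 4.
    by rewrite -normrX ger0_norm // exprn_even_ge0.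
  apply: lerXn2r; rewrite ?nnegrE //; last exact: s_step.
  by apply: mulr_ge0; exact: ltW.
move: jets; under eq_bigr do rewrite sumrB.
rewrite sumrB => jets.
have e : A1 * y ^+ 3 =
  N%:R * (2 / 3 * D ^+ 3 / m ^+ 2 + 2 * D ^+ 2 / m) ^+ 2 / (4 * c) / f%:R ^+ 3 +
  N%:R * (D ^+ 4 / (2 * m ^+ 7)) * y ^+ 3 by rewrite /A1 mulrDl /y exprVn.
lra.
Qed.

Lemma C_SLERP_lower : exists2 C0 : R, 0 < C0 &
  forall f : nat, (0 < f)%N -> C0 / f%:R <= C_SLERP u v f.
Proof.
exists (2 / 3 * \sum_i (Num.sqrt (v 0 i) - Num.sqrt (u 0 i)) ^+ 2).
  by rewrite mulr_gt0 ?chord_gt0 // divr_gt0.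
by move=> f f0; exact: C_SLERP_ge.
Qed.

End NearOptimality.

(** * Passage to the infimum and normalization by powers of the angle *)

Theorem theorem3 (R : realType) (N : nat) (hN : (2 <= N)%N)
    (eps : R) (heps : 0 < eps)
    (wstart wend : 'rV[R]_N)
    (hstart : simplex wstart) (hend : simplex wend)
    (hmin : forall t : R, 0 <= t <= 1 ->
              forall i, eps <= slerp wstart wend t 0 i) :
  (exists A : R, forall f : nat, (1 <= f)%N ->
     4 * Omega wstart wend / eps <= f%:R ->
     0 <= C_SLERP wstart wend f - C_star wstart wend f
       <= A * Omega wstart wend ^+ 4 / f%:R ^+ 3) /\
  (0 < Omega wstart wend ->
   exists B : R, forall f : nat, (1 <= f)%N ->
     4 * Omega wstart wend / eps <= f%:R ->
     `| (C_SLERP wstart wend f - C_star wstart wend f) / C_SLERP wstart wend f |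
       <= B * (Omega wstart wend ^+ 2 / f%:R ^+ 2)).
Proof.
have slerp_path f : (0 < f)%N ->
    is_path wstart wend f (fun k => slerp wstart wend (k%:R / f%:R)).
  move=> f0; apply: slerp_is_path => // t t01 i.
  exact: lt_le_trans heps (hmin t t01 i).
have gap_ge0 f : (0 < f)%N -> 0 <= C_SLERP wstart wend f - C_star wstart wend f.
  by move=> f0; rewrite subr_ge0; apply: C_star_le; exact: slerp_path.
have star_ge f b : (0 < f)%N ->
    (forall w, is_path wstart wend f w -> b <= path_cost f w) ->
    b <= C_star wstart wend f.
  move=> f0 hb; apply: lb_le_inf; last by move=> _ [w hw <-]; exact: hb.
  by eexists; eexists; first exact: slerp_path.
have [Om0|Om0] := eqVneq (Omega wstart wend) 0.
  split; last by rewrite Om0 ltxx.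
  exists 0 => f f0 _; rewrite gap_ge0 //= !mul0r subr_le0.
  have -> : C_SLERP wstart wend f = 0.
    rewrite /C_SLERP path_costE big1 // => k _.
    rewrite /slerp Om0 eqxx KL_sqrt // big1 // => i _.
    by rewrite sqrt_klxx // sqrtr_gt0; exact: hstart.1.
  by apply: star_ge => // w; exact: path_cost_ge0.
have Om_gt0 : 0 < Omega wstart wend.
  by rewrite lt_neqAle eq_sym Om0; have /andP[] := Omega_bounds hstart hend.
have [A [A0 hA]] := slerp_near_optimal heps hstart hend hmin Om_gt0.
have gap_le f : (0 < f)%N ->
    C_SLERP wstart wend f - C_star wstart wend f <= A / f%:R ^+ 3.
  move=> f0; rewrite lerBlDl -lerBlDr.
  by apply: star_ge => // w; exact: hA.
split.
  (* The constant may depend on the endpoints, so the power of the positive angle is inserted by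
     division. *)
  exists (A / Omega wstart wend ^+ 4) => f f0 _; rewrite gap_ge0 //=.
  by rewrite divfK ?expf_neq0 // gap_le.
move=> _; have [C0 C0_gt0 hC] := C_SLERP_lower heps hstart hend hmin Om_gt0.
(* The gap is at most [A / f^3] and the SLERP cost at least [C0 / f], so the quotient has order
   [f^-2]. *)
exists (A / C0 / Omega wstart wend ^+ 2) => f f0 _.
have fR : 0 < f%:R :> R by rewrite ltr0n.
have Cf0 : 0 < C0 / f%:R by rewrite divr_gt0.
have CS0 : 0 < C_SLERP wstart wend f by exact: lt_le_trans Cf0 (hC f f0).
rewrite ger0_norm; last by rewrite divr_ge0 ?gap_ge0 // ltW.
have -> : A / C0 / Omega wstart wend ^+ 2 * (Omega wstart wend ^+ 2 / f%:R ^+ 2) =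
    A / f%:R ^+ 3 * (C0 / f%:R)^-1.
  by field; rewrite !lt0r_neq0.
apply: ler_pM; rewrite ?gap_ge0 ?gap_le ?invr_ge0 ?(ltW CS0) //.
by rewrite lef_pV2 ?posrE // hC.
Qed.
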